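(* Suppose $0\leqslant\lambda\leqslant\lambda_0$. Then the following hold. 1) For any finite set $Q\subset\mathbb{Z}^\nu$ and any $A\in\Sigma_Q$ the limit $P_{\lambda,Q}(A)=\lim_{N\to\infty}P_N(A)$ (taken over $N\in\mathbb{N}$ with $Q\subseteq\Lambda_N$) exists. 2) For any finite set $Q\subset\mathbb{Z}^\nu$, $P_{\lambda,Q}$ is a probability measure on $(\Omega,\Sigma_Q)$.
   Context: Fix an integer $\nu\geqslant1$ and the lattice $\mathbb{Z}^\nu$ with the distance $\|\boldsymbol{s}-\boldsymbol{t}\|=\sum_{i=1}^\nu|s_i-t_i|$. For each $\boldsymbol{t}\in\mathbb{Z}^\nu$ let $P_{\boldsymbol{t}}$ be a given Borel probability measure on $\mathbb{R}$. Let $\Omega=\mathbb{R}^{\mathbb{Z}^\nu}$ (all functions $\omega:\mathbb{Z}^\nu\to\mathbb{R}$), $\Sigma$ the product $\sigma$-algebra generated by the sets $\{\omega:\omega(\boldsymbol{t})\in F\}$ ($\boldsymbol{t}\in\mathbb{Z}^\nu$, $F\subseteq\mathbb{R}$ Borel), and $P_0$ the product probability measure on $(\Omega,\Sigma)$ of the measures $P_{\boldsymbol{t}}$. $\langle\cdot\rangle_0$ denotes expectation with respect to $P_0$. For finite $B\subset\mathbb{Z}^\nu$, $\Sigma_B$ is the $\sigma$-algebra generated by the sets $\{\omega:\omega(\boldsymbol{t})\in F\}$ with $\boldsymbol{t}\in B$, $F$ Borel. A graph $(V,E)$ with $V$ a finite subset of $\mathbb{Z}^\nu$ (edges are pairs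 of distinct vertices) is called 1-connected if it is connected and every edge joins two points at distance 1. For a finite $B\subset\mathbb{Z}^\nu$ with at least two elements, its size $S(B)$ is the minimum number of edges of 1-connected graphs $(V,E)$ with $B\subseteq V$. Fix a real number $r\geqslant1$ and let $\mathfrak{B}$ be the collection of finite sets $B\subset\mathbb{Z}^\nu$ with at least two elements and $1\leqslant S(B)\leqslant r$. Let $\lambda\geqslant0$ be real, and for each $B\in\mathfrak{B}$ let $\Phi_B$ be a $\Sigma_B$-measurable real random variable on $\Omega$ with $|\Phi_B|\leqslant\lambda$. For $N\in\mathbb{N}$ let $\Lambda_N=\{\boldsymbol{t}\in\mathbb{Z}^\nu: |t_i|\leqslant N,\ i=1,\dots,\nu\}$, $U_N=\sum_{B\in\mathfrak{B},\,B\subseteq\Lambda_N}\Phi_B$, and $P_N(A)=\dfrac{\langle I_A e^{U_N}\rangle_0}{\langle e^{U_N}\rangle_0}$ for $A\in\Sigma$, where $I_A$ is the indicator of $A$. For $B\in\mathfrak{B}$ let $l(B)$ be the number of sets $C\in\mathfrak{B}$ with $C\cap B\neq\varnothing$ (including $C=B$), and $L=\max\{l(B): B\in\mathfrak{B}\}$ (a finite number depending only on $\nu$ and $r$). Put $\lambda_0=\dfrac{1}{50L(8\nu)^{2r}}$. *)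

(* Defs.v *)
From HB Require Import structures.
From mathcomp Require Import all_boot all_order all_algebra finmap.
From mathcomp Require Import all_classical all_reals all_analysis.

Set Implicit Arguments.
Unset Strict Implicit.
Unset Printing Implicit Defensive.
Import Order.TTheory GRing.Theory Num.Theory numFieldNormedType.Exports.
Local Open Scope classical_set_scope.
Local Open Scope ring_scope.

Definition lattice (nu : nat) := {ffun 'I_nu -> int}.

Definition dist (nu : nat) (s t : lattice nu) : int :=
  \sum_(i < nu) `|s i - t i|.

Definition box (nu N : nat) : set (lattice nu) :=
  [set t | forall i, `|t i| <= N%:Z].

(* A graph is given by its vertex set [V] and its set [E] of edges, an edge
   being the unordered pair of its end points. *)
Definition is_graph (nu : nat) (V : {fset lattice nu})
    (E : {fset {fset lattice nu}}) : Prop :=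
  forall e, e \in E -> (e `<=` V)%fset /\ #|` e| = 2%N.

Definition graph_connected (nu : nat) (V : {fset lattice nu})
    (E : {fset {fset lattice nu}}) : Prop :=
  forall s t, s \in V -> t \in V ->
    exists2 p : seq (lattice nu),
      path (fun x y => [fset x; y]%fset \in E) s p & last s p = t.

Definition one_connected (nu : nat) (V : {fset lattice nu})
    (E : {fset {fset lattice nu}}) : Prop :=
  [/\ is_graph V E, graph_connected V E &
      forall s t, [fset s; t]%fset \in E -> dist s t = 1].

(* The default value 0, for sets without a minimum or maximum, is not used
   below: every finite [B] lies in the vertex set of a 1-connected graph, and
   for 1 <= nu and 1 <= r the [bond_degree]s form a finite nonempty set. *)
Definition nat_min (A : set nat) : nat := xget 0%N (A `&` lbound A).

Definition nat_max (A : set nat) : nat := xget 0%N (A `&` ubound A).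

(* S(B): the minimum number of edges of the 1-connected graphs covering B. *)
Definition bond_size (nu : nat) (B : {fset lattice nu}) : nat :=
  nat_min [set n | exists V E,
    [/\ one_connected V E, (B `<=` V)%fset & #|` E| = n]].

Definition bonds (R : realType) (nu : nat) (r : R) : set {fset lattice nu} :=
  [set B | [/\ (2 <= #|` B|)%N, (1 <= bond_size B)%N & (bond_size B)%:R <= r]].

(* l(B), L and lambda_0; [fset_set] is faithful here as the counted set is
   finite. *)
Definition bond_degree (R : realType) (nu : nat) (r : R)
    (B : {fset lattice nu}) : nat :=
  #|` fset_set [set C | bonds r C /\ (C `&` B)%fset <> fset0]|.

Definition max_bond_degree (R : realType) (nu : nat) (r : R) : nat :=
  nat_max [set bond_degree r B | B in bonds (nu := nu) r].

Definition lambda0 (R : realType) (nu : nat) (r : R) : R :=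
  1 / (50 * (max_bond_degree nu r)%:R * (8 * nu%:R) `^ (2 * r)).

(* The named type lets the library infer that configurations are a pointed
   type, as required by [g_sigma_algebraType]. *)
Definition config (R : realType) (nu : nat) : Type := lattice nu -> R.

HB.instance Definition _ (R : realType) (nu : nat) :=
  Pointed.copy (config R nu) (forall t : lattice nu, (fun=> R) t).

(* Generators of the sigma-algebra of the coordinates in [D]. *)
Definition cylinders (R : realType) (nu : nat) (D : set (lattice nu)) :
    set (set (config R nu)) :=
  [set A | exists2 t, D t &
     exists2 F : set R, measurable F & A = [set w | F (w t)]].

Notation config_on R D := (g_sigma_algebraType (@cylinders R _ D)).

(* The library has no infinite product of measures. This is the defining
   property of the product of the [P t], which determines [P0] uniquely. *)
Definition is_product_measure (R : realType) (nu : nat)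
    (P : lattice nu -> probability R R)
    (P0 : probability (config_on R [set: lattice nu]) R) : Prop :=
  forall (B : {fset lattice nu}) (F : lattice nu -> set R),
    (forall t, t \in B -> measurable (F t)) ->
    P0 [set w | forall t, t \in B -> F t (w t)] =
    (\prod_(t <- B) P t (F t))%E.

Definition energy (R : realType) (nu : nat) (r : R)
    (Phi : {fset lattice nu} -> config R nu -> R)
    (N : nat) (w : config R nu) : R :=
  \sum_(B \in [set B | bonds r B /\ [set` B] `<=` box N]) Phi B w.

(* P_N(A) *)
Definition finite_volume (R : realType) (nu : nat)
    (P0 : probability (config_on R [set: lattice nu]) R) (r : R)
    (Phi : {fset lattice nu} -> config R nu -> R)
    (N : nat) (A : set (config R nu)) : R :=
  fine ('E_P0[fun w => \1_A w * expR (energy r Phi N w)]) /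
  fine ('E_P0[fun w => expR (energy r Phi N w)]).

(* N --> oo among the N such that Q is included in the box of radius N *)
Definition volumes (nu : nat) (Q : {fset lattice nu}) : set_system nat :=
  within [set N | [set` Q] `<=` box N] \oo.

Definition limit_measure (R : realType) (nu : nat)
    (P0 : probability (config_on R [set: lattice nu]) R) (r : R)
    (Phi : {fset lattice nu} -> config R nu -> R)
    (Q : {fset lattice nu}) (A : set (config R nu)) : R :=
  lim (finite_volume P0 r Phi N A @[N --> volumes Q]).

(* Main.v *)
(* Write <f>_N for the expectation of f under P_N.  For N <= M the difference
   <f>_N - <f>_M is, up to normalization, the integral of
   (f(w) - f(w')) e^(U_N(w) + U_M(w')) over two independent copies w, w' of the
   configuration (disagreement percolation).  For each bond B of Lambda_N,
   starting from those that meet the support Q of f, split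
   e^(Phi_B(w) + Phi_B(w')) as e^(-2 lambda) + h_B.  Here 0 <= h_B is at most
   4 lambda times the left-hand side: a bond is open with probability at most
   4 lambda.  If the open cluster of Q does not reach a bond that leaves
   Lambda_N, exchanging w and w' on this cluster changes the sign of the
   integrand, and the contribution vanishes.  As 4 lambda L 2^r < 1, the cluster
   reaches the boundary with probability O(2^(-N)), the weight 2^(radius B)
   being superharmonic for the exploration.  The limit is thus uniform over the
   events of Sigma_Q, and it inherits sigma-additivity because each P_N is
   dominated by a multiple of P_0. *)

From HB Require Import structures.
Require Import Defs.
From mathcomp Require Import all_boot all_order all_algebra finmap.
From mathcomp Require Import all_classical all_reals all_analysis.
From mathcomp Require Import measurable_realfun zify ring lra.

Import Order.TTheory GRing.Theory Num.Theory numFieldNormedType.Exports.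
Local Open Scope classical_set_scope.
Local Open Scope ring_scope.

Set Implicit Arguments.
Unset Strict Implicit.

(** * Geometry of the bonds *)

Definition radius (nu : nat) (t : lattice nu) : nat := \sum_(i < nu) `|t i|%N.

Definition set_radius (nu : nat) (B : {fset lattice nu}) : nat :=
  \max_(t <- B) radius t.

Lemma radius_step (nu : nat) (s t : lattice nu) :
  dist s t = 1 -> (radius t <= (radius s).+1)%N.
Proof.
move=> h.
have h1 : (\sum_(i < nu) `|s i - t i|)%N = 1%N.
  have : (\sum_(i < nu) `|s i - t i|)%N%:Z = 1.
    by rewrite -h /dist raddf_sum/=; apply: eq_bigr => i _; rewrite abszE.
  by case.
rewrite -addn1 -h1.
rewrite /radius -big_split/=; apply: leq_sum => i _; lia.
Qed.

Lemma pairmap_sub (T : choiceType) (x : T) (p : seq T) (e : {fset T}) :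
  e \in pairmap (fun x y => [fset x; y]%fset) x p -> {subset e <= x :: p}.
Proof.
elim: p x => //= y p IH x; rewrite inE => /predU1P[->|/IH h] z.
  by rewrite !inE => /orP[]/eqP ->; rewrite eqxx ?orbT.
by move=> /h zp; rewrite inE zp orbT.
Qed.

(** The edges along a self-avoiding path are pairwise distinct: the first one contains [x], while
    the later ones consist of points of [p]. *)
Lemma uniq_path_size (T : choiceType) (E : {fset {fset T}}) (x : T)
    (p : seq T) :
  path (fun x y => [fset x; y]%fset \in E) x p -> uniq (x :: p) ->
  (size p <= #|` E|)%N.
Proof.
move=> xp up; rewrite -(size_pairmap (fun x y => [fset x; y]%fset) x p).
apply: uniq_leq_size; elim: p x xp up => //= y p IH x /andP[xy yp] /andP[xp up].
- rewrite IH// andbT; apply: contra xp => /pairmap_sub; apply.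
  by rewrite !inE eqxx.
- by move=> e; rewrite inE => /predU1P[->//|]; apply: IH.
Qed.

Lemma radius_path (nu : nat) (E : {fset {fset lattice nu}}) (s : lattice nu)
    (p : seq (lattice nu)) :
  (forall s t, [fset s; t]%fset \in E -> dist s t = 1) ->
  path (fun x y => [fset x; y]%fset \in E) s p ->
  (radius (last s p) <= radius s + size p)%N.
Proof.
move=> hE; elim: p s => [|y p IH] s /=; first by rewrite addn0.
move=> /andP[/hE/radius_step sy /IH yp].
by apply: leq_trans yp _; rewrite addnS -addSn leq_add2r.
Qed.

(** In a graph realizing S(B), [s] and [t] are joined by a self-avoiding path, which has at most
    S(B) edges; each edge changes the radius by at most 1. *)
Lemma radius_bond_size (nu : nat) (B : {fset lattice nu}) (s t : lattice nu) :
  (1 <= bond_size B)%N -> s \in B -> t \in B ->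
  (radius t <= radius s + bond_size B)%N.
Proof.
(* As S(B) >= 1, the value is not the default 0 of [nat_min], so the minimum is attained by some
   graph. *)
rewrite /bond_size /nat_min; case: xgetP => [n _ [[V [E [oneE BV cE]]] _] _|//].
move=> /(fsubsetP BV) sV /(fsubsetP BV) tV.
have [_ /(_ _ _ sV tV)[p sp <-] hE] := oneE.
case: (shortenP sp) => p' sp' up' _.
rewrite (leq_trans (radius_path hE sp')) // leq_add2l -cE.
exact: uniq_path_size sp' up'.
Qed.

Lemma finite_box (nu N : nat) : finite_set (@box nu N).
Proof.
pose f (g : {ffun 'I_nu -> 'I_(N + N).+1}) : lattice nu :=
  [ffun i => (g i : nat)%:Z - N%:Z].
apply: (@sub_finite_set _ _ (f @` setT)); last first.
  by apply: finite_image; exact: finite_finset.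
move=> t /= tN; exists [ffun i => inord (absz (t i + N%:Z))] => //.
apply/ffunP => i; have : `|t i| <= N%:Z := tN i.
by rewrite !ffunE; move: (t i) => z zN; rewrite inordK; lia.
Qed.

Lemma finite_subfsets (T : choiceType) (X : set T) :
  finite_set X -> finite_set [set B : {fset T} | [set` B] `<=` X].
Proof.
move=> fX; apply: (@sub_finite_set _ _ [set` fpowerset (fset_set X)]) => //.
move=> B /= BX; rewrite fpowersetE; apply/fsubsetP => t /BX Xt.
by rewrite in_fset_set// inE.
Qed.

Lemma radius_box (nu N : nat) (t : lattice nu) : (radius t <= N)%N -> box N t.
Proof.
move=> tN i; rewrite -abszE lez_nat; apply: leq_trans tN.
by rewrite /radius (bigD1 i)//= leq_addr.
Qed.

Lemma radius_le_set (nu : nat) (B : {fset lattice nu}) (t : lattice nu) :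
  t \in B -> (radius t <= set_radius B)%N.
Proof. by move=> tB; rewrite /set_radius (big_rem t)//= leq_maxl. Qed.

Lemma bond_size_truncn (R : realType) (nu : nat) (r : R)
    (B : {fset lattice nu}) :
  bonds r B -> (bond_size B <= Num.truncn r)%N.
Proof.
case=> _ _ Br; rewrite truncn_ge_nat//; exact: le_trans Br.
Qed.

(** Start from a point common to [B] and [C]: along [C] the radius grows by at most S(C), an integer
    not exceeding r. *)
Lemma set_radius_touch (R : realType) (nu : nat) (r : R)
    (B C : {fset lattice nu}) :
  bonds r C -> (C `&` B)%fset <> fset0 ->
  (set_radius C <= set_radius B + Num.truncn r)%N.
Proof.
move=> bC /eqP/fset0Pn[s]; rewrite inE => /andP[sC sB].
apply/bigmax_leqP_seq => t tC _.
apply: leq_trans (radius_bond_size (let: And3 _ h _ := bC in h) sC tC) _.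
by rewrite leq_add ?radius_le_set ?bond_size_truncn.
Qed.

(** Makes [fset_set] faithful in [bond_degree]: bonds touching [B] stay in a box. *)
Lemma finite_touching (R : realType) (nu : nat) (r : R)
    (B : {fset lattice nu}) :
  finite_set [set C | bonds r C /\ (C `&` B)%fset <> fset0].
Proof.
apply: sub_finite_set
  (finite_subfsets (finite_box nu (set_radius B + Num.truncn r))).
move=> C /= [bC CB] t /= tC; apply: radius_box.
exact: leq_trans (radius_le_set tC) (set_radius_touch bC CB).
Qed.

(** A nonzero value is not the default of [nat_max], hence it is a true maximum. *)
Lemma bond_degree_le_max (R : realType) (nu : nat) (r : R)
    (B : {fset lattice nu}) :
  max_bond_degree nu r <> 0%N -> bonds r B ->
  (bond_degree r B <= max_bond_degree nu r)%N.
Proof.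
rewrite /max_bond_degree /nat_max; case: xgetP => // L _ [_ +] _ bB.
by apply; exists B.
Qed.

Lemma sum_touching_le (R : realType) (nu : nat) (r : R)
    (B : {fset lattice nu}) (s : seq {fset lattice nu}) :
  uniq s -> (forall C, C \in s -> bonds r C) ->
  \sum_(C <- s | (C `&` B)%fset != fset0) 2 ^+ set_radius C
    <= (bond_degree r B)%:R * 2 ^+ (set_radius B + Num.truncn r) :> R.
Proof.
move=> us sb; rewrite -big_filter.
set s' := seq.filter _ _.
have s'P C : C \in s' -> bonds r C /\ (C `&` B)%fset <> fset0.
  by rewrite mem_filter => /andP[/eqP ? /sb].
apply: (@le_trans _ _ (\sum_(C <- s') 2 ^+ (set_radius B + Num.truncn r))).
  rewrite big_seq [leRHS]big_seq; apply: ler_sum => C /s'P[bC CB].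
  by rewrite ler_eXn2l ?ltr1n// set_radius_touch.
rewrite big_const_seq count_predT iter_addr_0 -[leLHS]mulr_natl.
rewrite ler_wpM2r ?exprn_ge0// ler_nat.
apply: uniq_leq_size; first exact: filter_uniq.
by move=> C /s'P h; rewrite in_fset_set ?inE//; exact: finite_touching.
Qed.

Lemma bond_degree_lambda_le (R : realType) (nu : nat) (r lambda : R)
    (B : {fset lattice nu}) :
  (1 <= nu)%N -> 1 <= r -> 0 <= lambda <= lambda0 nu r -> bonds r B ->
  4 * lambda * (bond_degree r B)%:R * 2 ^+ Num.truncn r <= 1.
Proof.
move=> nu1 r1 /andP[l0 ll] bB.
(* If L took the default value 0, then [lambda0] would be 0 because the inverse of 0 is 0, and
   lambda would vanish. *)
have [L0|/eqP L0] := eqVneq (max_bond_degree nu r) 0%N.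
  move: ll; rewrite /lambda0 L0 mulr0 mul0r invr0 mulr0 => ll.
  have -> : lambda = 0 by apply/eqP; rewrite eq_le ll.
  by rewrite !(mulr0, mul0r) ler01.
have dL := bond_degree_le_max L0 bB.
have {}L0 : 0 < (max_bond_degree nu r)%:R :> R by rewrite ltr0n lt0n; apply/eqP.
(* Here 2^floor(r) <= 2^(2r) <= (8 nu)^(2r); the product to be estimated is then at most 4 / 50. *)
have pw : 2 ^+ Num.truncn r <= (8 * nu%:R) `^ (2 * r) :> R.
  rewrite -powR_mulrn//; apply: (@le_trans _ _ (2 `^ (2 * r))).
    rewrite ler_powR ?ler1n//.
    apply: (@le_trans _ _ r); last by lra.
    by rewrite truncn_le; lra.
  have : 1 <= nu%:R :> R by rewrite ler1n.
  by move=> ?; rewrite ge0_ler_powR// ?nnegrE; lra.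
set W := _ `^ _ in pw ll *.
have W0 : 0 < W by apply: lt_le_trans pw; rewrite exprn_gt0.
have : 4 * lambda * (max_bond_degree nu r)%:R * W <= 1.
  apply: (@le_trans _ _ (4 * lambda0 nu r * (max_bond_degree nu r)%:R * W)).
    by rewrite !ler_pM2r// ler_pM2l.
  rewrite /lambda0 -/W.
  suff -> : 4 * (1 / (50 * (max_bond_degree nu r)%:R * W)) *
    (max_bond_degree nu r)%:R * W = 4 / 50 :> R by lra.
  by field; rewrite !gt_eqF.
apply: le_trans; rewrite ler_pM// ?exprn_ge0 ?mulr_ge0//.
by rewrite ler_wpM2l ?mulr_ge0// ler_nat.
Qed.

(** Superharmonicity of the weight 2^(radius B): at most l(B) bonds touch [B], each weighs at most
    2^floor(r) times as much as [B], and 4 lambda l(B) 2^floor(r) <= 1. *)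
Lemma coupling_superharmonic (R : realType) (nu : nat) (r lambda : R)
    (B : {fset lattice nu}) (s : seq {fset lattice nu}) :
  (1 <= nu)%N -> 1 <= r -> 0 <= lambda <= lambda0 nu r -> bonds r B ->
  uniq s -> (forall C, C \in s -> bonds r C) ->
  4 * lambda * \sum_(C <- s | (C `&` B)%fset != fset0) 2 ^+ set_radius C
    <= 2 ^+ set_radius B.
Proof.
move=> nu1 r1 ll bB us sb.
have [l0 _] := andP ll.
apply: le_trans (ler_wpM2l _ (sum_touching_le B us sb)) _.
  by rewrite mulr_ge0.
have := bond_degree_lambda_le nu1 r1 ll bB.
rewrite exprD => h.
have -> : 4 * lambda * ((bond_degree r B)%:R * (2 ^+ set_radius B * 2 ^+ Num.truncn r)) =
  4 * lambda * (bond_degree r B)%:R * 2 ^+ Num.truncn r * 2 ^+ set_radius B by ring.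
by rewrite ler_piMl ?exprn_ge0.
Qed.

(** * Bounded measurable functions *)

(** The class of all integrands below: stable under the algebraic operations and integrable for
    every probability measure, so that integrability needs no separate estimate. *)
Definition bounded_measurable (R : realType) d (T : measurableType d)
    (f : T -> R) : Prop :=
  measurable_fun [set: T] f /\ exists M : R, forall x, `|f x| <= M.

Section bounded_measurable.
Variables (R : realType) (d : measure_display) (T : measurableType d).
Implicit Types f g : T -> R.
Local Notation bm := bounded_measurable.

Lemma bm_cst (c : R) : bm (fun _ : T => c).
Proof. by split; [exact: measurable_cst|exists `|c|]. Qed.

Lemma bmM f g : bm f -> bm g -> bm (fun x => f x * g x).
Proof.
move=> [mf [M fM]] [mg [N gN]]; split; first exact: measurable_funM.
by exists (M * N) => x; rewrite normrM ler_pM.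
Qed.

Lemma bmB f g : bm f -> bm g -> bm (fun x => f x - g x).
Proof.
move=> [mf [M fM]] [mg [N gN]]; split; first exact: measurable_funB.
by exists (M + N) => x; apply: le_trans (ler_normB _ _) _; rewrite lerD.
Qed.

Lemma bm_norm f : bm f -> bm (fun x => `|f x|).
Proof.
move=> [mf [M fM]]; split; first exact: measurableT_comp.
by exists M => x; rewrite normr_id.
Qed.

Lemma bm_prod (I : eqType) (s : seq I) (F : I -> T -> R) :
  (forall i, i \in s -> bm (F i)) -> bm (fun x => \prod_(i <- s) F i x).
Proof.
elim: s => [|i s IH] h.
  by under [X in bm X]funext => x do rewrite big_nil; exact: bm_cst.
under [X in bm X]funext => x do rewrite big_cons.
apply: bmM; first by apply: h; rewrite mem_head.
by apply: IH => j js; apply: h; rewrite inE js orbT.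
Qed.

Lemma bm_expR f : bm f -> bm (fun x => expR (f x)).
Proof.
move=> [mf [M fM]]; split; first exact: measurableT_comp.
exists (expR M) => x; rewrite ger0_norm ?expR_ge0// ler_expR.
exact: le_trans (ler_norm _) (fM x).
Qed.

Lemma bm_indic (A : set T) : measurable A -> bm (\1_A : T -> R).
Proof.
move=> mA; split; first exact: measurable_indic.
by exists 1 => x; rewrite indicE; case: (_ \in _); rewrite ?normr1 ?normr0.
Qed.

Lemma bm_comp d' (T' : measurableType d') (h : T' -> T) f :
  measurable_fun setT h -> bm f -> bm (f \o h).
Proof.
move=> mh [mf [M fM]]; split; first exact: measurableT_comp.
by exists M => x; exact: fM.
Qed.

Variable P : probability T R.

Lemma bm_integrable f : bm f -> P.-integrable setT (EFin \o f).
Proof.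
move=> [mf [M fM]]; apply: measurable_bounded_integrable => //.
  exact: le_lt_trans (probability_le1 P measurableT) (ltry _).
exists M; split; first exact: num_real.
by move=> x Mx y _; apply: le_trans (fM y) (ltW Mx).
Qed.

End bounded_measurable.
#[local] Notation bm := bounded_measurable.

Lemma Rintegral_tensor (R : realType) d1 d2 (T1 : measurableType d1)
    (T2 : measurableType d2) (P1 : probability T1 R) (P2 : probability T2 R)
    (f : T1 -> R) (g : T2 -> R) : bm f -> bm g ->
  \int[(P1 \x P2)%E]_z (f z.1 * g z.2) =
  (\int[P1]_x f x) * (\int[P2]_y g y).
Proof.
move=> bf bg.
have b : bm (fun z : T1 * T2 => f z.1 * g z.2).
  apply: bmM; first by apply: (bm_comp (h := fst)) bf; exact: measurable_fst.
  by apply: (bm_comp (h := snd)) bg; exact: measurable_snd.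
rewrite /Rintegral -(integral12_prod_meas1 (bm_integrable (P1 \x P2)%E b)).
rewrite /fubini_F /=.
have ig := bm_integrable P2 bg.
under eq_integral => x _.
  under eq_integral => y _ do rewrite EFinM.
  rewrite integralZl//=.
  rewrite -[X in (_ * X)%E]fineK; last exact: integrable_fin_num.
  over.
rewrite integralZr//=; last exact: bm_integrable.
by rewrite fineM//; exact/integrable_fin_num/bm_integrable.
Qed.

Lemma Rintegral_prob_cst (R : realType) d (T : measurableType d)
    (P : probability T R) (c : R) : \int[P]_x c = c.
Proof.
by rewrite Rintegral_cst// -[LHS]/(c * fine (P setT)) probability_setT mulr1.
Qed.

(** * Independence of disjoint sets of coordinates *)

Section independence.
Variables (R : realType) (nu : nat).
Implicit Types (D : set (lattice nu)).

(** A pi-system generating the sigma-algebra of the coordinates in [D], on which the product formula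
    gives the value of [P0]. *)
Definition rectangles D : set (set (config R nu)) :=
  [set A | exists (B : {fset lattice nu}) (F : lattice nu -> set R),
    [/\ [set` B] `<=` D, forall t, measurable (F t) &
        A = [set w | forall t, t \in B -> F t (w t)]]].

Lemma rectanglesT D : rectangles D setT.
Proof.
exists fset0, (fun=> setT); split=> //.
by apply/esym; rewrite -subTset => w _ t /=; rewrite inE.
Qed.

Lemma rectanglesI D : setI_closed (rectangles D).
Proof.
move=> _ _ [B [F [BD mF ->]]] [B' [F' [BD' mF' ->]]].
(* Both rectangles are padded with the whole line off their bases, so that sides can be intersected
   over the union of the bases. *)
pose S (B : {fset lattice nu}) (F : lattice nu -> set R) t :=
  if t \in B then F t else setT.
exists (B `|` B')%fset, (fun t => S B F t `&` S B' F' t); split.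
- by move=> t /=; rewrite inE => /orP[/BD|/BD'].
- by move=> t; apply: measurableI; rewrite /S; case: ifP.
apply/seteqP; split=> w.
  move=> [h h'] t _; split; rewrite /S; case: ifP => // tB;
  [exact: h|exact: h'].
move=> h; split=> t tB; have := h t; rewrite /S inE tB ?orbT.
  by move=> /(_ isT)[].
by move=> /(_ isT)[].
Qed.

Lemma sub_rectangles D : rectangles D `<=` <<s cylinders D>>.
Proof.
move=> _ [B [F [BD mF ->]]].
have -> : [set w : config R nu | forall t, t \in B -> F t (w t)] =
    \big[setI/setT]_(t <- B) [set w | F t (w t)].
  apply/seteqP; split=> w.
    move=> h; rewrite big_seq; elim/big_ind: _ => // t tB; exact: h.
  move=> + t tB; by rewrite (big_rem t)//= => -[].
rewrite big_seq.
elim/big_ind: _ => [|A A' mA mA'|t tB].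
- exact: (@measurableT _ (config_on R D)).
- exact: (@measurableI _ (config_on R D)).
- by apply: sub_sigma_algebra; exists t; [exact: BD|exists (F t)].
Qed.

Lemma sigma_rectangles D : <<s cylinders D>> = <<s rectangles D>>.
Proof.
apply/seteqP; split; apply: smallest_sub.
- exact: smallest_sigma_algebra.
- move=> _ [t Dt [F mF ->]]; apply: sub_sigma_algebra.
  exists [fset t]%fset, (fun=> F); split=> //.
    by move=> s /=; rewrite inE => /eqP ->.
  apply/seteqP; split=> w /=; first by move=> ? s; rewrite inE => /eqP ->.
  by apply; rewrite inE.
- exact: smallest_sigma_algebra.
- exact: sub_rectangles.
Qed.

Lemma sigma_cylindersS D D' : D `<=` D' ->
  <<s @cylinders R nu D>> `<=` <<s cylinders D'>>.
Proof.
move=> DD'; apply: smallest_sub; first exact: smallest_sigma_algebra.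
move=> _ [t Dt [F mF ->]]; apply: sub_sigma_algebra.
by exists t; [exact: DD'|exists F].
Qed.

(** Passing to a sub-sigma-algebra is expressed as the identity between two measurable structures on
    the same configurations. *)
Lemma measurable_idS D D' : D `<=` D' ->
  measurable_fun [set: config_on R D'] (idfun : config_on R D' -> config_on R D).
Proof. by move=> DD' _ A mA; rewrite setTI; exact: sigma_cylindersS mA. Qed.

Lemma bm_sub D D' (f : config R nu -> R) : D `<=` D' ->
  bm (f : config_on R D -> R) -> bm (f : config_on R D' -> R).
Proof. by move=> DD'; exact: bm_comp (measurable_idS DD'). Qed.

Variable P : lattice nu -> probability R R.
Variable P0 : probability (config_on R [set: lattice nu]) R.
Local Notation Om := (config_on R [set: lattice nu]).

Lemma sigma_cylinders_measurable D (A : set (config R nu)) :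
  <<s cylinders D>> A -> measurable (A : set Om).
Proof. by apply: sigma_cylindersS. Qed.

(** Both sides are finite measures in [A]: the restriction of [P0] to [A'], and [P0] scaled by the
    mass of [A']. They agree on a generating pi-system, hence everywhere. *)
Lemma indep_sigma_rectangles D (A' : set Om) : measurable A' ->
  (forall A : set Om, rectangles D A -> P0 (A `&` A') = P0 A * P0 A')%E ->
  forall A : set Om, <<s cylinders D>> A -> (P0 (A `&` A') = P0 A * P0 A')%E.
Proof.
move=> mA' h A; rewrite sigma_rectangles => mA.
have PA' : P0 A' \is a fin_num by exact: fin_num_measure.
have PA'0 : 0 <= fine (P0 A') by exact: fine_ge0.
transitivity (mscale (NngNum PA'0) P0 A); last by rewrite /mscale/= fineK// muleC.
rewrite -[LHS]/(mrestr P0 mA' A).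
apply: (@g_sigma_algebra_measure_unique _ _ Om (rectangles D) _ (fun=> setT)).
- by move=> B /sub_rectangles /sigma_cylinders_measurable.
- by move=> _; exact: rectanglesT.
- by rewrite bigcup_const//; exists 0%N.
- exact: rectanglesI.
- move=> B rB; transitivity (P0 B * P0 A')%E; first exact: h.
  by rewrite -[RHS]/((fine (P0 A'))%:E * P0 B)%E fineK// muleC.
- move=> _; rewrite -[ltLHS]/(P0 (setT `&` A')) setTI.
  exact: le_lt_trans (probability_le1 P0 mA') (ltry _).
- exact: mA.
Qed.

Hypothesis hP0 : is_product_measure P P0.

(** The intersection is a rectangle over the union of the two bases; these are disjoint, so the
    product formula splits. *)
Lemma rectangles_indep D D' (A A' : set Om) : D `&` D' = set0 ->
  rectangles D A -> rectangles D' A' -> (P0 (A `&` A') = P0 A * P0 A')%E.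
Proof.
move=> DD' [B [F [BD mF ->]]] [B' [F' [BD' mF' ->]]].
have tBB' t : t \in B -> t \in B' -> False.
  by move=> /BD Dt /BD' D't; suff : (D `&` D') t by rewrite DD'.
pose G t := if t \in B then F t else F' t.
have -> : [set w : Om | forall t, t \in B -> F t (w t)] `&`
    [set w | forall t, t \in B' -> F' t (w t)] =
    [set w | forall t, t \in (B `|` B')%fset -> G t (w t)].
  apply/seteqP; split=> w.
    move=> [h h'] t; rewrite inE /G; case: ifPn => [tB _|_ /= tB'].
      exact: h.
    exact: h'.
  move=> h; split=> t tB; have := h t; rewrite inE tB ?orbT /G ?tB; first exact.
  by case: ifPn => [/tBB' /(_ tB)//|_]; exact.
rewrite !hP0//; last by move=> t _; rewrite /G; case: ifP.
have -> : (\prod_(t <- (B `|` B')%fset) P t (G t) =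
    \prod_(t <- B ++ B') P t (G t))%E.
  apply: perm_big; apply: uniq_perm => [||t]; first exact: fset_uniq.
    rewrite cat_uniq !fset_uniq/= andbT; apply/hasPn => t tB'.
    by apply/negP => /tBB' /(_ tB').
  by rewrite mem_cat inE.
rewrite big_cat/=; congr (_ * _)%E; rewrite big_seq [RHS]big_seq;
  apply: eq_bigr => t tB; rewrite /G.
  by rewrite tB.
by case: ifPn => // /tBB' /(_ tB).
Qed.

Lemma indep_sets D D' (A A' : set (config R nu)) : D `&` D' = set0 ->
  <<s cylinders D>> A -> <<s cylinders D'>> A' ->
  (P0 (A `&` A') = P0 A * P0 A')%E.
Proof.
move=> DD' mA mA'.
apply: (@indep_sigma_rectangles D) mA; first exact: sigma_cylinders_measurable mA'.
move=> B rB; rewrite setIC muleC.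
apply: (@indep_sigma_rectangles D') mA'.
  exact: sigma_cylinders_measurable (sub_rectangles rB).
move=> B' rB'; rewrite setIC muleC; exact: rectangles_indep rB rB'.
Qed.

(** By independence of events, the diagonal map w -> (w, w) carries [P0] to the product of its
    restrictions to the coordinates in [D] and in [D']; Fubini then factorizes the integral. *)
Lemma indep_fun D D' (f g : config R nu -> R) : D `&` D' = set0 ->
  bm (f : config_on R D -> R) -> bm (g : config_on R D' -> R) ->
  \int[P0]_w (f w * g w) = (\int[P0]_w f w) * (\int[P0]_w g w).
Proof.
move=> DD' bf bg.
have mX D1 := @measurable_idS D1 setT (@subsetT _ _).
pose X D1 : {mfun Om >-> config_on R D1} :=
  HB.pack (idfun : Om -> config_on R D1)
    (isMeasurableFun.Build _ _ _ _ _ (mX D1)).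
have mY : measurable_fun [set: Om]
    (fun w => (w, w) : config_on R D * config_on R D').
  exact: measurable_fun_pair (mX D) (mX D').
pose Y : {mfun Om >-> (config_on R D * config_on R D')%type} :=
  HB.pack (fun w : Om => (w, w) : config_on R D * config_on R D')
    (isMeasurableFun.Build _ _ _ _ _ mY).
have E Z : measurable Z ->
    (distribution P0 (X D) \x distribution P0 (X D'))%E Z = distribution P0 Y Z.
  apply: product_measure_unique => A A' mA mA'.
  exact: indep_sets DD' mA mA'.
have tr d (T : measurableType d) (Z : {mfun Om >-> T}) (h : T -> R) : bm h ->
    \int[distribution P0 Z]_x h x = \int[P0]_w h (Z w).
  move=> bh; rewrite /Rintegral integral_distribution//.
    exact/measurable_EFinP/(proj1 bh).
  by apply: (@bm_integrable _ _ _ P0 (h \o Z)); apply: bm_comp bh.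
have := tr _ _ (X D) _ bf => /= <-.
have := tr _ _ (X D') _ bg => /= <-.
rewrite -Rintegral_tensor//.
have bfg : bm (fun z : config_on R D * config_on R D' => f z.1 * g z.2).
  apply: bmM; first by apply: (bm_comp (h := fst)) bf; exact: measurable_fst.
  by apply: (bm_comp (h := snd)) bg; exact: measurable_snd.
have := tr _ _ Y _ bfg => /= <-.
congr fine; apply: eq_measure_integral => Z mZ _; exact/esym/E.
Qed.

End independence.

(** * Disagreement percolation *)

Section disagreement.
Variables (R : realType) (nu : nat).
Local Notation Om := (config_on R [set: lattice nu]).

(** Functions of the coordinates in [D] that change sign when the two copies are exchanged.
    Generating them from elementary tensors reduces statements about them, by induction, to Fubini
    on products. *)
Inductive antisymmetric (D : set (lattice nu)) : (Om * Om -> R) -> Prop :=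
| antisymmetric_tensor (a b : config R nu -> R) :
    bm (a : config_on R D -> R) -> bm (b : config_on R D -> R) ->
    antisymmetric D (fun z => a z.1 * b z.2 - b z.1 * a z.2)
| antisymmetric_comb (k : R) F F' :
    antisymmetric D F -> antisymmetric D F' ->
    antisymmetric D (fun z => F z - k * F' z).

Lemma bm_tensor (a b : Om -> R) :
  bm a -> bm b -> bm (fun z : Om * Om => a z.1 * b z.2).
Proof.
move=> ba bb; apply: bmM.
  by apply: (bm_comp (h := fst)) ba; exact: measurable_fst.
by apply: (bm_comp (h := snd)) bb; exact: measurable_snd.
Qed.

Lemma bm_antisymmetric D F : antisymmetric D F -> bm F.
Proof.
elim=> {F} [a b /(bm_sub (@subsetT _ D)) ba /(bm_sub (@subsetT _ D)) bb|
            k F F' _ bF _ bF'].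
  by apply: bmB; exact: bm_tensor.
by apply: bmB => //; apply: bmM => //; exact: bm_cst.
Qed.

(** The new factor is symmetric in the two copies. On a tensor, psi psi' is absorbed into [a] and
    [b], and [- k] is provided by [antisymmetric_comb]. *)
Lemma antisymmetric_mul D D' F (psi : config R nu -> R) (k : R) :
  antisymmetric D F -> bm (psi : config_on R D' -> R) ->
  antisymmetric (D `|` D') (fun z => F z * (psi z.1 * psi z.2 - k)).
Proof.
move=> aF /(bm_sub (@subsetUr _ D D')) bpsi.
elim: aF => {F} [a b|k' F F' _ IF _ IF'].
  move=> /(bm_sub (@subsetUl _ D D')) ba /(bm_sub (@subsetUl _ D D')) bb.
  have := antisymmetric_comb k
    (antisymmetric_tensor (bmM ba bpsi) (bmM bb bpsi))
    (antisymmetric_tensor ba bb).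
  by congr antisymmetric; apply/funext => z; ring.
have := antisymmetric_comb k' IF IF'.
by congr antisymmetric; apply/funext => z; ring.
Qed.

Variable P : lattice nu -> probability R R.
Variable P0 : probability Om R.
Hypothesis hP0 : is_product_measure P P0.
Local Notation J F := (\int[(P0 \x P0)%E]_z F z).

(** For a tensor, independence turns each of the two terms into the same product of the means of
    [a], [b], [g] and [g']. The outer weights [g] and [g'] may differ, as they do when the second
    copy lives in a larger box. *)
Lemma antisymmetric_vanish D D' F (g g' : config R nu -> R) :
  D `&` D' = set0 -> antisymmetric D F ->
  bm (g : config_on R D' -> R) -> bm (g' : config_on R D' -> R) ->
  J (fun z => F z * (g z.1 * g' z.2)) = 0.
Proof.
move=> DD' aF bg bg'.
have bgT := bm_sub (@subsetT _ D') bg.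
have bg'T := bm_sub (@subsetT _ D') bg'.
elim: aF => {F} [a b ba bb|k F F' aF IF aF' IF'].
  have baT := bm_sub (@subsetT _ D) ba.
  have bbT := bm_sub (@subsetT _ D) bb.
  under eq_Rintegral => z _.
    have -> : (a z.1 * b z.2 - b z.1 * a z.2) * (g z.1 * g' z.2) =
      (a z.1 * g z.1) * (b z.2 * g' z.2) - (b z.1 * g z.1) * (a z.2 * g' z.2).
      by ring.
    over.
  rewrite RintegralB//; first last.
  - exact: bm_integrable (bm_tensor (bmM bbT bgT) (bmM baT bg'T)).
  - exact: bm_integrable (bm_tensor (bmM baT bgT) (bmM bbT bg'T)).
  rewrite (Rintegral_tensor P0 P0 (bmM baT bgT) (bmM bbT bg'T)).
  rewrite (Rintegral_tensor P0 P0 (bmM bbT bgT) (bmM baT bg'T)).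
  rewrite (indep_fun hP0 DD' ba bg) (indep_fun hP0 DD' bb bg').
  rewrite (indep_fun hP0 DD' bb bg) (indep_fun hP0 DD' ba bg').
  by ring.
under eq_Rintegral => z _.
  rewrite mulrBl -mulrA; over.
have bFg := bmM (bm_antisymmetric aF) (bm_tensor bgT bg'T).
have bFg' := bmM (bm_antisymmetric aF') (bm_tensor bgT bg'T).
rewrite RintegralB//; first last.
- exact: bm_integrable (bmM (bm_cst _ k) bFg').
- exact: bm_integrable bFg.
rewrite RintegralZl//; last exact: bm_integrable bFg'.
by rewrite IF IF' mulr0 subr0.
Qed.

(** * Exploration of the open bonds around the support *)

Variables (lambda : R) (psi : {fset lattice nu} -> config R nu -> R).
Hypothesis lambda_ge0 : 0 <= lambda.

(** What the expansion uses of a Boltzmann factor psi_B = e^(Phi_B). *)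
Definition coupling (B : {fset lattice nu}) : Prop :=
  bm (psi B : config_on R [set` B] -> R) /\
  forall w, expR (- lambda) <= psi B w <= expR lambda.

Lemma coupling_bm (D : set (lattice nu)) (s : seq {fset lattice nu}) :
  (forall B, B \in s -> coupling B) ->
  (forall B, B \in s -> [set` B] `<=` D) ->
  bm (fun w : config_on R D => \prod_(B <- s) psi B w).
Proof.
move=> cs sD; apply: bm_prod => B Bs.
exact: bm_sub (sD _ Bs) (proj1 (cs _ Bs)).
Qed.

Lemma coupling_bmT (s : seq {fset lattice nu}) :
  (forall B, B \in s -> coupling B) -> bm (fun w : Om => \prod_(B <- s) psi B w).
Proof. by move=> cs; apply: coupling_bm. Qed.

Lemma coupling_gt0 (s : seq {fset lattice nu}) w :
  (forall B, B \in s -> coupling B) -> 0 < \prod_(B <- s) psi B w.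
Proof.
move=> cs; rewrite big_seq prodr_gt0// => B /cs[_ /(_ w)/andP[+ _]].
exact: lt_le_trans (expR_gt0 _).
Qed.

Lemma partition_gt0 (s : seq {fset lattice nu}) :
  (forall B, B \in s -> coupling B) ->
  0 < \int[P0]_w \prod_(B <- s) psi B w.
Proof.
move=> cs; apply: (@lt_le_trans _ _ (\int[P0]_w (expR (- lambda) ^+ size s))).
  by rewrite Rintegral_prob_cst exprn_gt0// expR_gt0.
apply: le_Rintegral => //.
- exact: bm_integrable (bm_cst _ _).
- exact: bm_integrable (coupling_bmT cs).
move=> w _; elim: s cs => [|B s IH] cs; first by rewrite big_nil.
rewrite big_cons exprS ler_pM ?exprn_ge0 ?expR_ge0//.
  by have [_ /(_ w)/andP[]] := cs B (mem_head _ _).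
by apply: IH => C Cs; apply: cs; rewrite inE Cs orbT.
Qed.

(** The weight e^(U_N(w) + U_M(w')): [G] lists the bonds of the smaller box, and [bd] those added by
    the larger one, which act on the second copy only. *)
Definition joint_weight (G bd : seq {fset lattice nu}) (z : Om * Om) : R :=
  (\prod_(B <- G) psi B z.1) * (\prod_(B <- G ++ bd) psi B z.2).

Lemma bm_joint_weight G bd : (forall B, B \in G ++ bd -> coupling B) ->
  bm (joint_weight G bd).
Proof.
move=> cs; apply: (bm_tensor (a := fun w => \prod_(B <- G) psi B w)
  (b := fun w => \prod_(B <- G ++ bd) psi B w)); apply: coupling_bmT => // B BG.
by apply: cs; rewrite mem_cat BG.
Qed.

Lemma joint_weight_ge0 G bd z : (forall B, B \in G ++ bd -> coupling B) ->
  0 <= joint_weight G bd z.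
Proof.
move=> cs; rewrite mulr_ge0// ltW// coupling_gt0// => B BG.
by apply: cs; rewrite mem_cat BG.
Qed.

Variable c : {fset lattice nu} -> R.
Hypothesis c_ge0 : forall B, 0 <= c B.

(** For a superharmonic [c] that is at least 1 on [bd], this bounds the relative weight of the
    explorations that start from [T] and reach [bd]. *)
Definition contact (T : {fset lattice nu}) (s : seq {fset lattice nu}) : R :=
  \sum_(B <- s | (B `&` T)%fset != fset0) c B.

Lemma contact_ge0 T s : 0 <= contact T s.
Proof. exact: sumr_ge0. Qed.

Lemma contact_cons T B s :
  contact T (B :: s) =
  (if (B `&` T)%fset != fset0 then c B else 0) + contact T s.
Proof. by rewrite /contact big_cons; case: ifP => // _; rewrite add0r. Qed.

Lemma contactU T B s : contact (T `|` B)%fset s <= contact T s + contact B s.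
Proof.
elim: s => [|C s IH]; first by rewrite /contact !big_nil addr0.
rewrite !contact_cons fsetIUr fsetU_eq0.
have := c_ge0 C; case: eqP; case: eqP => /=; lra.
Qed.

Lemma contact_perm T s s' : perm_eq s s' -> contact T s = contact T s'.
Proof. by move=> ss'; apply: perm_big. Qed.

Lemma coupling_split B w w' : coupling B ->
  0 <= psi B w * psi B w' - expR (- lambda) ^+ 2 <=
  4 * lambda * (psi B w * psi B w').
Proof.
move=> [_ h]; have /andP[l u] := h w; have /andP[l' u'] := h w'.
have e0 : 0 < expR (- lambda) := expR_gt0 _.
have ee : expR (- lambda) * expR lambda = 1.
  by rewrite -expRD addNr expR0.
set x := psi B w in l u *; set y := psi B w' in l' u' *.
have xy0 : 0 < x * y by rewrite mulr_gt0//; exact: lt_le_trans e0 _.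
apply/andP; split.
  by rewrite subr_ge0 expr2 ler_pM// ltW.
have xyle : x * y <= expR lambda ^+ 2.
  by rewrite expr2 ler_pM// ltW//; exact: lt_le_trans e0 _.
(* The upper bound amounts to (1 - 4 lambda) x y <= e^(-2 lambda); it follows from 1 - 4 lambda <=
   e^(-4 lambda) and x y <= e^(2 lambda). *)
have e4 : 1 - 4 * lambda <= expR (- lambda) ^+ 4.
  rewrite -expRM_natl; apply: le_trans (expR_ge1Dx _); lra.
suff : (1 - 4 * lambda) * (x * y) <= expR (- lambda) ^+ 2 by lra.
apply: le_trans (ler_wpM2r (ltW xy0) e4) _.
apply: le_trans (ler_wpM2l _ xyle) _; first by rewrite exprn_ge0 ?ltW.
rewrite (_ : _ * _ = expR (- lambda) ^+ 2 * (expR (- lambda) * expR lambda) ^+ 2).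
  by rewrite ee expr1n mulr1.
by ring.
Qed.

(** Bookkeeping of one step: [x] and [x1] are the contributions of the dropped and of the opened
    bond B, [A] and [A1] the integrals of the absolute values without B, [X] that with B, and [s],
    [s'] the contacts of T and of B with the remaining bonds. *)
Lemma exploration_step (k s s' cB A A1 X x x1 : R) :
  X = k * A + A1 -> x <= k * (s * A) -> x1 <= (s + s') * A1 ->
  s' * A1 <= cB * X -> x + x1 <= (cB + s) * X.
Proof. by move=> -> *; lra. Qed.

(* Induction on the number of unexplored bonds: a bond B of G that meets T is
   split as psi psi' = k + h with k = e^(-2 lambda).  In the first term B is
   dropped; in the second one the explored region T grows by B, at relative
   cost h / (psi psi') <= 4 lambda.  When the exploration stops without
   reaching bd, the integral vanishes by antisymmetry. *)
Lemma disagreement_bound (G bd : seq {fset lattice nu})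
    (T : {fset lattice nu}) (F : Om * Om -> R) :
  (forall B, B \in G ++ bd -> coupling B) ->
  (forall B, B \in G -> 4 * lambda * contact B (G ++ bd) <= c B) ->
  (forall B, B \in bd -> 1 <= c B) ->
  antisymmetric [set` T] F ->
  `|J (fun z => F z * joint_weight G bd z)| <=
  contact T (G ++ bd) * J (fun z => `|F z| * joint_weight G bd z).
Proof.
have [n] := ubnP (size G).
elim: n G T F => // n IH G T F sG cs hG hbd aF.
have bF := bm_antisymmetric aF.
have bW := bm_joint_weight cs.
have J_ge0 : 0 <= J (fun z => `|F z| * joint_weight G bd z).
  by apply: Rintegral_ge0 => z _; rewrite mulr_ge0// joint_weight_ge0.
have [/hasP[B BG BT]|/hasPn noG] :=
  boolP (has (fun B => (B `&` T)%fset != fset0) G); last first.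
  have [/hasP[B Bbd BT]|/hasPn nobd] :=
    boolP (has (fun B => (B `&` T)%fset != fset0) bd); last first.
    suff -> : J (fun z => F z * joint_weight G bd z) = 0.
      by rewrite normr0 mulr_ge0// contact_ge0.
    have sub (s : seq {fset lattice nu}) :
        {in s, forall B, ~~ ((B `&` T)%fset != fset0)} ->
        forall B, B \in s -> [set` B] `<=` ~` [set` T].
      move=> sT B /sT; rewrite negbK => /eqP BT t /= tB tT.
      have : t \in (B `&` T)%fset by rewrite inE; apply/andP.
      by rewrite BT inE.
    have csG B : B \in G -> coupling B by move=> BG; apply: cs; rewrite mem_cat BG.
    have noGbd : {in G ++ bd, forall B, ~~ ((B `&` T)%fset != fset0)}.
      by move=> B; rewrite mem_cat => /orP[/noG|/nobd].
    exact: antisymmetric_vanish (setICr _) aF (coupling_bm csG (sub _ noG))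
      (coupling_bm cs (sub _ noGbd)).
  (* A bond of [bd] meets [T], so the contact is at least 1 and the trivial bound by the integral of
     the absolute value suffices. *)
  apply: (@le_trans _ _ (J (fun z => `|F z| * joint_weight G bd z))).
    apply: le_trans (le_normr_Rintegral _ (bm_integrable _ (bmM bF bW))) _ => //.
    rewrite le_eqVlt; apply/orP; left; apply/eqP; apply: eq_Rintegral => z _.
    by rewrite normrM (ger0_norm (joint_weight_ge0 _ cs)).
  rewrite ler_peMl//.
  rewrite (contact_perm T (perm_to_rem (_ : B \in G ++ bd))); last first.
    by rewrite mem_cat Bbd orbT.
  by rewrite contact_cons BT; have := hbd _ Bbd; have := contact_ge0 T (rem B (G ++ bd)); lra.
pose G1 := rem B G.
have pG : perm_eq G (B :: G1) := perm_to_rem BG.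
have pGbd : perm_eq (G ++ bd) (B :: (G1 ++ bd)).
  by rewrite -cat_cons perm_cat2r.
have cB : coupling B by apply: cs; rewrite mem_cat BG.
have sub1 C : C \in G1 ++ bd -> C \in G ++ bd.
  by rewrite !mem_cat (perm_mem pG) inE => /orP[]->; rewrite !orbT.
have cs1 C : C \in G1 ++ bd -> coupling C by move=> /sub1/cs.
have le1 S : contact S (G1 ++ bd) <= contact S (G ++ bd).
  rewrite (contact_perm S pGbd) contact_cons lerDr; case: ifP => // _.
have l4 : 0 <= 4 * lambda by rewrite mulr_ge0.
have hG1 C : C \in G1 -> 4 * lambda * contact C (G1 ++ bd) <= c C.
  move=> CG1; apply: le_trans (hG C _); first by rewrite ler_wpM2l.
  by rewrite (perm_mem pG) inE CG1 orbT.
have sG1 : (size G1 < n)%N by rewrite -ltnS -[(size G1).+1]/(size (B :: G1)) -(perm_size pG).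
pose k := expR (- lambda) ^+ 2.
pose F1 z := F z * (psi B z.1 * psi B z.2 - k).
have aF1 : antisymmetric [set` (T `|` B)%fset] F1.
  rewrite (_ : [set` _] = [set` T] `|` [set` B]); last first.
    apply/seteqP; split=> t /=; rewrite inE; [by move=> /orP|by move=> ?; apply/orP].
  exact: antisymmetric_mul aF (proj1 cB).
have bF1 := bm_antisymmetric aF1.
have bW1 := bm_joint_weight cs1.
have WE z : joint_weight G bd z = psi B z.1 * psi B z.2 * joint_weight G1 bd z.
  rewrite /joint_weight (perm_big _ pG)/= [X in _ * X](perm_big _ pGbd)/=.
  by rewrite !big_cons; ring.
have h0 z := coupling_split z.1 z.2 cB.
have JF : J (fun z => F z * joint_weight G bd z) =
    k * J (fun z => F z * joint_weight G1 bd z) +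
    J (fun z => F1 z * joint_weight G1 bd z).
  rewrite -RintegralZl//; last exact: bm_integrable (bmM bF bW1).
  rewrite -RintegralD//; first last.
  - exact: bm_integrable (bmM bF1 bW1).
  - exact: bm_integrable (bmM (bm_cst _ k) (bmM bF bW1)).
  by apply: eq_Rintegral => z _; rewrite WE /F1; ring.
have JnF : J (fun z => `|F z| * joint_weight G bd z) =
    k * J (fun z => `|F z| * joint_weight G1 bd z) +
    J (fun z => `|F1 z| * joint_weight G1 bd z).
  rewrite -RintegralZl//; last exact: bm_integrable (bmM (bm_norm bF) bW1).
  rewrite -RintegralD//; first last.
  - exact: bm_integrable (bmM (bm_norm bF1) bW1).
  - exact: bm_integrable (bmM (bm_cst _ k) (bmM (bm_norm bF) bW1)).
  apply: eq_Rintegral => z _; have /andP[h _] := h0 z.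
  by rewrite WE /F1 normrM (ger0_norm h) /k; ring.
have JF1 : J (fun z => `|F1 z| * joint_weight G1 bd z) <=
    4 * lambda * J (fun z => `|F z| * joint_weight G bd z).
  rewrite -RintegralZl//; last exact: bm_integrable (bmM (bm_norm bF) bW).
  apply: le_Rintegral => //.
  - exact: bm_integrable (bmM (bm_norm bF1) bW1).
  - exact: bm_integrable (bmM (bm_cst _ _) (bmM (bm_norm bF) bW)).
  move=> z _; have /andP[h h'] := h0 z.
  rewrite WE /F1 normrM (ger0_norm h).
  rewrite [leRHS](_ : _ = `|F z| * (4 * lambda * (psi B z.1 * psi B z.2)) *
    joint_weight G1 bd z); last by ring.
  by rewrite ler_wpM2r ?joint_weight_ge0// ler_wpM2l.
have I1 := IH G1 T F sG1 cs1 hG1 hbd aF.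
have I2 := IH G1 (T `|` B)%fset F1 sG1 cs1 hG1 hbd aF1.
have k0 : 0 <= k by rewrite exprn_ge0 ?expR_ge0.
rewrite JF (contact_perm T pGbd) contact_cons BT.
apply: le_trans (ler_normD _ _) _; rewrite normrM (ger0_norm k0).
have I1' := ler_wpM2l k0 I1.
have A1 : 0 <= J (fun z => `|F1 z| * joint_weight G1 bd z).
  by apply: Rintegral_ge0 => z _; rewrite mulr_ge0// joint_weight_ge0.
have I2' := le_trans I2 (ler_wpM2r A1 (contactU T B (G1 ++ bd))).
(* Superharmonicity enters here: what the opened bond [B] may reach later is paid for by the term c
   B that [B] itself contributes to the contact of [T]. *)
have cB' : 4 * lambda * contact B (G1 ++ bd) <= c B.
  exact: le_trans (ler_wpM2l l4 (le1 B)) (hG B BG).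
have I3 : contact B (G1 ++ bd) * J (fun z => `|F1 z| * joint_weight G1 bd z) <=
    c B * J (fun z => `|F z| * joint_weight G bd z).
  apply: le_trans (ler_wpM2l (contact_ge0 _ _) JF1) _.
  by rewrite mulrA [_ * (4 * _)]mulrC ler_wpM2r.
exact: exploration_step JnF I1' I2' I3.
Qed.

(** Over the common denominator Z Z' the numerator is the integral of the antisymmetric function
    f(w) - f(w') against the joint weight. Since |f(w) - f(w')| <= 1, the integral of its absolute
    value is at most Z Z', which cancels. *)
Lemma finite_volume_diff (G bd : seq {fset lattice nu}) (Q : {fset lattice nu})
    (f : config R nu -> R) :
  bm (f : config_on R [set` Q] -> R) -> (forall w, 0 <= f w <= 1) ->
  (forall B, B \in G ++ bd -> coupling B) ->
  (forall B, B \in G -> 4 * lambda * contact B (G ++ bd) <= c B) ->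
  (forall B, B \in bd -> 1 <= c B) ->
  `|\int[P0]_w (f w * \prod_(B <- G) psi B w) /
      \int[P0]_w \prod_(B <- G) psi B w -
    \int[P0]_w (f w * \prod_(B <- G ++ bd) psi B w) /
      \int[P0]_w \prod_(B <- G ++ bd) psi B w| <= contact Q (G ++ bd).
Proof.
move=> bf f01 cs hG hbd.
have csG B : B \in G -> coupling B by move=> BG; apply: cs; rewrite mem_cat BG.
have bfT : bm (f : Om -> R) := bm_sub (@subsetT _ _) bf.
have bG := coupling_bmT csG.
have bGbd := coupling_bmT cs.
have := disagreement_bound cs hG hbd
  (antisymmetric_tensor bf (bm_cst (config_on R [set` Q]) 1)).
have bW := bm_joint_weight cs.
set Z := \int[P0]_w \prod_(B <- G) psi B w.
set Z' := \int[P0]_w \prod_(B <- G ++ bd) psi B w.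
set X := \int[P0]_w (f w * \prod_(B <- G) psi B w).
set X' := \int[P0]_w (f w * \prod_(B <- G ++ bd) psi B w).
have Z0 : 0 < Z := partition_gt0 csG.
have Z'0 : 0 < Z' := partition_gt0 cs.
have -> : J (fun z => (f z.1 * 1 - 1 * f z.2) * joint_weight G bd z) =
    X * Z' - Z * X'.
  rewrite -(Rintegral_tensor P0 P0 (bmM bfT bG) bGbd).
  rewrite -(Rintegral_tensor P0 P0 bG (bmM bfT bGbd)).
  rewrite -RintegralB//; first last.
  - exact: bm_integrable (bm_tensor bG (bmM bfT bGbd)).
  - exact: bm_integrable (bm_tensor (bmM bfT bG) bGbd).
  by apply: eq_Rintegral => z _; rewrite /joint_weight; ring.
move=> h.
have JW : J (fun z => `|f z.1 * 1 - 1 * f z.2| * joint_weight G bd z) <= Z * Z'.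
  rewrite -(Rintegral_tensor P0 P0 bG bGbd).
  apply: le_Rintegral => //.
  - have b1 : bm (fun _ : Om => 1 : R) := bm_cst _ 1.
    exact: bm_integrable
      (bmM (bm_norm (bmB (bm_tensor bfT b1) (bm_tensor b1 bfT))) bW).
  - exact: bm_integrable bW.
  move=> z _; rewrite ler_piMl ?joint_weight_ge0//.
  have := f01 z.1; have := f01 z.2; rewrite mulr1 mul1r ler_norml; lra.
have -> : X / Z - X' / Z' = (X * Z' - Z * X') / (Z * Z').
  by field; rewrite !gt_eqF.
rewrite normrM normfV (gtr0_norm (mulr_gt0 Z0 Z'0)) ler_pdivrMr ?mulr_gt0//.
apply: le_trans h _; apply: ler_wpM2l JW; exact: contact_ge0.
Qed.

End disagreement.

(** * Limits of finite-volume measures *)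

Lemma exists_exp2_small (R : realType) (K e : R) : 0 < e ->
  exists N : nat, K / 2 ^+ N < e.
Proof.
move=> e0; exists (Num.truncn (K / e)).+1.
rewrite ltr_pdivrMr ?exprn_gt0// -ltr_pdivrMl// mulrC.
apply: lt_le_trans (truncnS_gt (K / e)) _.
by rewrite -natrX ler_nat ltnW// ltn_expl.
Qed.

(** The rate survives in the limit; with a [K] common to all events it gives uniform convergence. *)
Lemma exp2_cauchy_limit (R : realType) (u : nat -> R) (K : R) :
  (forall N M, (N <= M)%N -> `|u N - u M| <= K / 2 ^+ N) ->
  cvgn u /\ forall N, `|u N - limn u| <= K / 2 ^+ N.
Proof.
move=> uK.
have cu : cvgn u.
  apply: cauchy_cvg; apply: cauchy_exP => e e0.
  have [N Ne] := exists_exp2_small K e0.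
  exists (u N); exists N => // M /= NM.
  exact: le_lt_trans (uK _ _ NM) Ne.
split=> // N; apply/ler_addgt0Pr => e e0.
have [M0 _ h] := (cvgrPdist_lt _ _).1 cu _ e0.
have := h (maxn N M0) (leq_maxr _ _); have := uK N (maxn N M0) (leq_maxl _ _).
set a := u N; set b := u (maxn _ _); set l := limn u => h1 h2.
rewrite (_ : a - l = (a - b) - (l - b)); last by ring.
by apply: le_trans (ler_normB _ _) _; rewrite lerD// ltW.
Qed.

Section dominated_additive.
Variables (R : realType) (d : measure_display) (T : measurableType d).

Definition finitely_additive (L : set T -> R) := forall A B,
  measurable A -> measurable B -> A `&` B = set0 -> L (A `|` B) = L A + L B.

Lemma finitely_additive_tail (L : set T -> R) (F : nat -> set T) :
  finitely_additive L -> (forall i, measurable (F i)) -> trivIset setT F ->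
  forall n, L (\bigcup_n F n) =
    \sum_(0 <= i < n) L (F i) + L (\bigcup_(k in [set k | (n <= k)%N]) F k).
Proof.
move=> addL mF tF; elim=> [|n ->].
  rewrite big_nil add0r; congr L; apply/seteqP.
  by split=> x [k _ Fx]; exists k.
rewrite big_nat_recr//= -addrA; congr (_ + _).
rewrite -addL//; last 2 first.
- exact: bigcup_measurable.
- rewrite -subset0 => x [Fnx [k /= nk Fkx]].
  by have := tF n k I I (ex_intro _ x (conj Fnx Fkx)) => e; rewrite e ltnn in nk.
congr L; apply/seteqP; split=> x.
  move=> [k /= nk Fkx]; have [e|kn] := eqVneq n k; first by left; rewrite e.
  by right; exists k => //=; rewrite ltn_neqAle kn.
by move=> [Fnx|[k /= /ltnW nk Fkx]]; [exists n => /=|exists k].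
Qed.

Variable m : probability T R.

(** By finite additivity the error of a partial sum is [L] of the remaining union, and the [m]-mass
    of that union tends to 0. *)
Lemma dominated_sigma_additive (L : set T -> R) :
  (forall A, measurable A -> 0 <= L A) -> finitely_additive L ->
  (forall e, 0 < e -> exists K, forall A, measurable A ->
     L A <= e + K * fine (m A)) ->
  forall F, (forall i, measurable (F i)) -> trivIset setT F ->
    \sum_(0 <= i < n) L (F i) @[n --> \oo] --> L (\bigcup_n F n).
Proof.
move=> L0 addL domL F mF tF.
have mU : measurable (\bigcup_n F n) by exact: bigcup_measurable.
have mR n : measurable (\bigcup_(k in [set k | (n <= k)%N]) F k).
  exact: bigcup_measurable.
have addm : finitely_additive (fine \o m).
  move=> A B mA mB AB; rewrite /= measureU// fineD//; exact: fin_num_measure.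
have cm : \sum_(0 <= i < n) fine (m (F i)) @[n --> \oo] --> fine (m (\bigcup_n F n)).
  have := @measure_semi_sigma_additive _ _ _ m F mF tF mU.
  have -> : (fun n => (\sum_(0 <= i < n) m (F i))%E) =
      (fun n => (\sum_(0 <= i < n) fine (m (F i)))%:E).
    apply/funext => n; rewrite -sumEFin; apply: eq_bigr => i _.
    by rewrite fineK//; exact: fin_num_measure.
  rewrite -[X in _ --> X -> _]fineK; last exact: fin_num_measure.
  by move=> /fine_cvgP[].
apply/cvgrPdist_lt => e e0.
have e2 : 0 < e / 2 by rewrite divr_gt0.
have [K LK] := domL _ e2.
(* [K] may be zero or negative, so [|K| + 1] serves as a positive divisor. *)
have K1 : 0 < `|K| + 1 by rewrite ltr_wpDl.
have [n0 _ h] := (cvgrPdist_lt _ _).1 cm _ (divr_gt0 e2 K1).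
exists n0 => // n /h /=.
have -> := finitely_additive_tail addL mF tF n.
have -> : fine (m (\bigcup_n F n)) = _ := finitely_additive_tail addm mF tF n.
rewrite ![_ + _ - _]addrC !addKr /=.
have := LK _ (mR n); have := L0 _ (mR n).
set x := L _; set y := fine _ => x0 xy.
have y0 : 0 <= y by exact: fine_ge0.
rewrite (ger0_norm x0) (ger0_norm y0) ltr_pdivlMr// => ye.
apply: le_lt_trans xy _; rewrite [ltRHS](splitr e) ltrD2l.
apply: le_lt_trans ye; rewrite mulrC ler_wpM2l//.
by rewrite (le_trans (ler_norm K))// lerDl.
Qed.

End dominated_additive.

(** Every box of radius at least [set_radius Q] contains [Q], so the restriction only removes
    finitely many N. *)
Lemma volumesE (nu : nat) (Q : {fset lattice nu}) : volumes Q = \oo.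
Proof.
apply/seteqP; split=> A.
  move=> [N _ NA]; exists (maxn N (set_radius Q)) => // M /=.
  rewrite geq_max => /andP[NM QM]; apply: NA => // t /= tQ.
  by apply: radius_box; apply: leq_trans (radius_le_set tQ) QM.
by move=> [N _ NA]; exists N => // M /NA.
Qed.

(** * Convergence of the finite-volume Gibbs measures *)

Section thermodynamic_limit.
Variables (R : realType) (nu : nat) (P : lattice nu -> probability R R).
Local Notation Om := (config_on R [set: lattice nu]).
Variable P0 : probability Om R.
Hypothesis hP0 : is_product_measure P P0.
Variables (r lambda : R) (Phi : {fset lattice nu} -> config R nu -> R).
Hypotheses (nu_ge1 : (1 <= nu)%N) (r_ge1 : 1 <= r).
Hypothesis Phi_measurable : forall B : {fset lattice nu}, bonds r B ->
  measurable_fun [set: config_on R [set` B]] (Phi B : config_on R [set` B] -> R).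
Hypothesis Phi_bound : forall B : {fset lattice nu}, bonds r B ->
  forall w, `|Phi B w| <= lambda.
Hypothesis lambda_small : 0 <= lambda <= lambda0 nu r.

Local Notation psi := (fun B w => expR (Phi B w)).

Definition bonds_in (N : nat) : {fset {fset lattice nu}} :=
  fset_set [set B | bonds r B /\ [set` B] `<=` box N].

Lemma bonds_inP N B :
  reflect (bonds r B /\ [set` B] `<=` box N) (B \in bonds_in N).
Proof.
rewrite in_fset_set; first by apply: (iffP idP) => [/set_mem|/mem_set].
by apply: sub_finite_set (finite_subfsets (finite_box nu N)) => C [].
Qed.

Lemma expR_energy N w : expR (energy r Phi N w) = \prod_(B <- bonds_in N) psi B w.
Proof.
rewrite /energy fsbig_finite/= ?expR_sum//.
by apply: sub_finite_set (finite_subfsets (finite_box nu N)) => C [].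
Qed.

Lemma finite_volumeE N A : finite_volume P0 r Phi N A =
  \int[P0]_w (\1_A w * \prod_(B <- bonds_in N) psi B w) /
  \int[P0]_w \prod_(B <- bonds_in N) psi B w.
Proof.
rewrite /finite_volume unlock /Rintegral.
by congr (fine _ / fine _); apply: eq_integral => w _; rewrite expR_energy.
Qed.

Lemma bond_coupling B : bonds r B -> coupling lambda psi B.
Proof.
move=> bB; have Pb := Phi_bound bB; split.
  apply: (@bm_expR _ _ (config_on R [set` B]) (Phi B)); split.
    exact: Phi_measurable.
  by exists lambda.
by move=> w; have := Pb w; rewrite ler_norml !ler_expR.
Qed.

Lemma bonds_in_coupling N B : B \in bonds_in N -> coupling lambda psi B.
Proof. by move=> /bonds_inP[/bond_coupling]. Qed.

Lemma bonds_inS N M : (N <= M)%N -> {subset bonds_in N <= bonds_in M}.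
Proof.
move=> NM B /bonds_inP[bB BN]; apply/bonds_inP; split=> // t /BN tN i.
by apply: le_trans (tN i) _; rewrite lez_nat.
Qed.

(** The bound of [sum_touching_le] at [Q]; it is the same for all events of Sigma_Q. *)
Definition boundary_weight (Q : {fset lattice nu}) : R :=
  (bond_degree r Q)%:R * 2 ^+ (set_radius Q + Num.truncn r).

Lemma finite_volume_cauchy (Q : {fset lattice nu}) (A : set (config R nu)) N M :
  <<s cylinders [set` Q] >> A -> (N <= M)%N ->
  `|finite_volume P0 r Phi N A - finite_volume P0 r Phi M A|
    <= boundary_weight Q / 2 ^+ N.
Proof.
move=> mA NM; rewrite !finite_volumeE.
pose bd : seq {fset lattice nu} :=
  [seq B <- bonds_in M | B \notin bonds_in N].
have pM : perm_eq (bonds_in M) (bonds_in N ++ bd).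
  apply: uniq_perm => [||B]; first exact: fset_uniq.
    rewrite cat_uniq filter_uniq ?fset_uniq// andbT/=.
    by apply/hasPn => B; rewrite mem_filter => /andP[].
  rewrite mem_cat mem_filter; case: (boolP (B \in bonds_in N)) => //=.
  exact: bonds_inS.
have uM : uniq (bonds_in N ++ bd) by rewrite -(perm_uniq pM) fset_uniq.
have bM B : B \in bonds_in N ++ bd -> bonds r B.
  by rewrite -(perm_mem pM) => /bonds_inP[].
have EM w : \prod_(B <- bonds_in M) psi B w = \prod_(B <- bonds_in N ++ bd) psi B w.
  exact: perm_big.
under [X in _ - X / _]eq_Rintegral => w _ do rewrite EM.
under [X in _ - _ / X]eq_Rintegral => w _ do rewrite EM.
(* The superharmonic weight is normalized to be at least 1 on [bd]: a bond that leaves the box of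
   radius N has [set_radius] at least N. *)
pose c (B : {fset lattice nu}) : R := 2 ^+ set_radius B / 2 ^+ N.
have c_ge0 B : 0 <= c B by rewrite divr_ge0 ?exprn_ge0.
have contactE T s : contact c T s =
    (\sum_(B <- s | (B `&` T)%fset != fset0) 2 ^+ set_radius B) / 2 ^+ N.
  by rewrite /contact mulr_suml.
have l0 : 0 <= lambda by case/andP: lambda_small.
apply: le_trans (finite_volume_diff hP0 l0 c_ge0 _ _ _ _ _) _ => //.
- exact: (@bm_indic R _ (config_on R [set` Q])).
- by move=> w; rewrite indicE ler0n lern1 leq_b1.
- by move=> B /bM/bond_coupling.
- move=> B BN; rewrite contactE mulrA ler_pM2r ?invr_gt0 ?exprn_gt0//.
  apply: (@coupling_superharmonic R nu r lambda) => //.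
  by apply: bM; rewrite mem_cat BN.
- move=> B; rewrite mem_filter => /andP[/bonds_inP BN /bonds_inP[bB _]].
  rewrite /c ler_pdivlMr ?exprn_gt0// mul1r ler_eXn2l ?ltr1n//.
  apply: contrapT => /negP; rewrite -ltnNge => BN'; apply: BN; split=> // t /= tB.
  by apply: radius_box; apply: leq_trans (radius_le_set tB) (ltnW BN').
- by rewrite contactE ler_pM2r ?invr_gt0 ?exprn_gt0// sum_touching_le.
Qed.

Lemma limit_measureE Q A :
  limit_measure P0 r Phi Q A = limn (fun N => finite_volume P0 r Phi N A).
Proof. by rewrite /limit_measure volumesE. Qed.

Lemma finite_volume_limit (Q : {fset lattice nu}) (A : set (config R nu)) :
  <<s cylinders [set` Q] >> A ->
  finite_volume P0 r Phi N A @[N --> \oo] --> limit_measure P0 r Phi Q A /\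
  forall N, `|finite_volume P0 r Phi N A - limit_measure P0 r Phi Q A|
    <= boundary_weight Q / 2 ^+ N.
Proof.
move=> mA; rewrite limit_measureE.
by apply: exp2_cauchy_limit => N M; exact: finite_volume_cauchy.
Qed.

Lemma partition_function_gt0 N :
  0 < \int[P0]_w \prod_(B <- bonds_in N) psi B w.
Proof. by apply: partition_gt0 => B; exact: bonds_in_coupling. Qed.

Lemma finite_volume_ge0 N A : 0 <= finite_volume P0 r Phi N A.
Proof.
rewrite finite_volumeE divr_ge0 ?(ltW (partition_function_gt0 N))//.
by apply: Rintegral_ge0 => w _; rewrite mulr_ge0 ?prodr_ge0.
Qed.

Lemma finite_volumeT N : finite_volume P0 r Phi N setT = 1.
Proof.
rewrite finite_volumeE; under eq_Rintegral => w _ do rewrite indicT mul1r.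
by rewrite divff// gt_eqF// partition_function_gt0.
Qed.

Lemma bm_boltzmann N : bm (fun w : Om => \prod_(B <- bonds_in N) psi B w).
Proof. by apply: coupling_bmT => B; exact: bonds_in_coupling. Qed.

Lemma finite_volume_additive N :
  finitely_additive (finite_volume P0 r Phi N : set Om -> R).
Proof.
move=> A B mA mB AB.
have bA : bm (\1_A : Om -> R) := bm_indic R mA.
have bB : bm (\1_B : Om -> R) := bm_indic R mB.
rewrite !finite_volumeE -mulrDl -RintegralD//.
- congr (_ / _); apply: eq_Rintegral => w _.
  rewrite -mulrDl; congr (_ * _); rewrite !indicE in_setU.
  have : ~~ ((w \in A) && (w \in B)) by rewrite -in_setI AB in_set0.
  by case: (w \in A); case: (w \in B) => //= _; rewrite ?addr0 ?add0r.
- exact: bm_integrable (bmM bA (bm_boltzmann N)).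
- exact: bm_integrable (bmM bB (bm_boltzmann N)).
Qed.

(** The density of P_N with respect to [P0] is a bounded Boltzmann weight divided by a positive
    constant. The bound [K] depends on N. *)
Lemma finite_volume_dominated N : exists K, forall A : set Om, measurable A ->
  finite_volume P0 r Phi N A <= K * fine (P0 A).
Proof.
have bG := bm_boltzmann N; have [mG [M GM]] := bG.
have Z0 := partition_function_gt0 N.
exists (M / \int[P0]_w \prod_(B <- bonds_in N) psi B w) => A mA.
have bA : bm (\1_A : Om -> R) := bm_indic R mA.
rewrite finite_volumeE mulrAC ler_pM2r ?invr_gt0//.
have -> : fine (P0 A) = \int[P0]_w (\1_A w : R).
  by rewrite /Rintegral integral_indic// setIT.
rewrite -RintegralZl//; last exact: bm_integrable bA.
apply: le_Rintegral => //.
- exact: bm_integrable (bmM bA bG).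
- exact: bm_integrable (bmM (bm_cst _ M) bA).
move=> w _; rewrite mulrC ler_wpM2r//.
exact: le_trans (ler_norm _) (GM w).
Qed.

(** * The limit as a probability measure on Sigma_Q *)

Section limit_on_finite_set.
Variable Q : {fset lattice nu}.
Local Notation OmQ := (config_on R [set` Q]).
Local Notation L := (limit_measure P0 r Phi Q).

Lemma limit_measure_ge0 (A : set OmQ) : measurable A -> 0 <= L A.
Proof.
move=> mA; have [cA _] := finite_volume_limit mA.
rewrite -(cvg_lim _ cA)//; apply: limr_ge; first exact: cvgP cA.
by apply: nearW => N; exact: finite_volume_ge0.
Qed.

Lemma limit_measure_additive : finitely_additive (L : set OmQ -> R).
Proof.
move=> A B mA mB AB.
have [cA _] := finite_volume_limit mA; have [cB _] := finite_volume_limit mB.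
have [cAB _] := finite_volume_limit (measurableU _ _ mA mB).
rewrite -(cvg_lim _ cAB)// -(cvg_lim _ (cvgD cA cB))//; congr (limn _).
apply/funext => N; apply: finite_volume_additive AB.
  exact: sigma_cylinders_measurable mA.
exact: sigma_cylinders_measurable mB.
Qed.

Lemma limit_measureT : L setT = 1.
Proof.
rewrite limit_measureE; under eq_fun do rewrite finite_volumeT.
exact: lim_cst.
Qed.

Lemma limit_measure_probability : exists mu : probability OmQ R,
  forall A : set (config R nu), <<s cylinders [set` Q] >> A -> mu A = (L A)%:E.
Proof.
have mX := @measurable_idS R nu [set` Q] setT (@subsetT _ _).
pose X : {mfun Om >-> OmQ} :=
  HB.pack (idfun : Om -> OmQ) (isMeasurableFun.Build _ _ _ _ _ mX).
have domL e : 0 < e -> exists K, forall A : set OmQ, measurable A ->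
    L A <= e + K * fine (distribution P0 X A).
  (* First N is chosen so that P_N is within e of the limit on all events of Sigma_Q at once; [K] is
     then the domination constant of this single P_N. *)
  move=> /(exists_exp2_small (boundary_weight Q))[N Ne].
  have [K PK] := finite_volume_dominated N; exists K => A mA.
  have [_ /(_ N)] := finite_volume_limit mA.
  have := PK A (sigma_cylinders_measurable mA).
  rewrite ler_distlC => h /andP[_ h'].
  apply: le_trans h' _; rewrite addrC lerD// ltW//.
(* A measure must be nonnegative on every set, whereas [L] is controlled on measurable sets only;
   elsewhere the value 0 is put. *)
pose mu (A : set OmQ) : \bar R := if `[<measurable A>] then (L A)%:E else 0%E.
have muE A : measurable A -> mu A = (L A)%:E by move=> mA; rewrite /mu asboolT.
have mu0 : mu set0 = 0%E.
  rewrite muE//; congr (_%:E).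
  have := limit_measure_additive measurable0 measurable0 (setI0 _).
  by rewrite setU0; lra.
have mu_ge0 A : (0 <= mu A)%E.
  by rewrite /mu; case: asboolP => // mA; rewrite lee_fin limit_measure_ge0.
have mu_sigma : semi_sigma_additive mu.
  move=> F mF tF mUF; rewrite muE//.
  have -> : (fun n => (\sum_(0 <= i < n) mu (F i))%E) =
      (fun n => (\sum_(0 <= i < n) L (F i))%:E).
    apply/funext => n; rewrite -sumEFin; apply: eq_bigr => i _; exact: muE.
  apply: cvg_EFin; first by apply: nearW.
  exact: dominated_sigma_additive limit_measure_ge0 limit_measure_additive domL
    _ mF tF.
have muT : mu setT = 1%E by rewrite muE// limit_measureT.
pose mM := isMeasure.Build _ _ _ mu mu0 mu_ge0 mu_sigma.
pose mm : {measure set OmQ -> \bar R} := HB.pack mu mM.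
pose mp := Measure_isProbability.Build _ _ _ mm muT.
pose mup : probability OmQ R := HB.pack mu mM mp.
by exists mup => A mA; exact: muE.
Qed.

End limit_on_finite_set.
End thermodynamic_limit.

Theorem theorem3p15 (R : realType) (nu : nat) (hnu : (1 <= nu)%N)
    (P : lattice nu -> probability R R)
    (P0 : probability (config_on R [set: lattice nu]) R)
    (hP0 : is_product_measure P P0)
    (r : R) (hr : 1 <= r) (lambda : R)
    (Phi : {fset lattice nu} -> config R nu -> R)
    (hPhi_meas : forall B : {fset lattice nu}, bonds r B ->
      measurable_fun [set: config_on R [set` B]] (Phi B : config_on R [set` B] -> R))
    (hPhi_bound : forall B : {fset lattice nu}, bonds r B ->
      forall w, `|Phi B w| <= lambda)
    (hlambda : 0 <= lambda <= lambda0 nu r) :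
  (forall (Q : {fset lattice nu}) (A : set (config R nu)),
     <<s cylinders [set` Q] >> A ->
     cvg (finite_volume P0 r Phi N A @[N --> volumes Q])) /\
  (forall Q : {fset lattice nu},
     exists mu : probability (config_on R [set` Q]) R,
       forall A : set (config R nu), <<s cylinders [set` Q] >> A ->
         mu A = (limit_measure P0 r Phi Q A)%:E).
Proof.
split=> [Q A mA|Q]; last first.
  exact: (limit_measure_probability hP0 hnu hr hPhi_meas hPhi_bound hlambda).
rewrite volumesE.
by have [/cvgP] := finite_volume_limit hP0 hnu hr hPhi_meas hPhi_bound hlambda mA.
Qed.
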